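(* Fix $d\le n$ and for $n,r\in\mathbb{N}$ write $$E_{(r)}(n):=\sup_{f\in\mathbb{R}[x]_d}\big\{f_{\min}-f_{(r)}:\|f\|_\infty=1\big\},\qquad E^{(r)}(n):=\sup_{f\in\mathbb{R}[x]_d}\big\{f^{(r)}-f_{\min}:\|f\|_\infty=1\big\}.$$ Let $C_d$ be the constant, depending only on $d$, specified in the context, and let $\varphi(t)=\tfrac12-\sqrt{t(1-t)}$. Then, for any $t\in[0,1/2]$, we have $$\lim_{r/n\to t}E^{(r)}(n)\le C_d\cdot\varphi(t),$$ and, if $d(d+1)\cdot\varphi(t)\le 1/2$, we also have $$\lim_{r/n\to t}E_{(r)}(n)\le 2\cdot C_d\cdot\varphi(t).$$ Here, the limit notation $r/n\to t$ means that the claimed convergence holds for all sequences $(n_j)_j$ and $(r_j)_j$ of integers such that $\lim_{j\to\infty}n_j=\infty$ and $\lim_{j\to\infty}r_j/n_j=t$.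
   Context: Write $\mathbb{B}^n=\{0,1\}^n$, $f_{\min}=\min_{x\in\mathbb{B}^n}f(x)$, $\|f\|_\infty=\max_{x\in\mathbb{B}^n}|f(x)|$, and let $\mu$ be the uniform probability measure on $\mathbb{B}^n$. $\mathbb{R}[x]_d$ denotes the real polynomials in $x=(x_1,\dots,x_n)$ of degree at most $d$, and $\Sigma_r$ the set of finite sums $\sum_i p_i^2$ with $p_i\in\mathbb{R}[x]_r$. The outer (sum-of-squares) and inner Lasserre bounds of order $r$ are $$f_{(r)}:=\sup\{\lambda\in\mathbb{R}:\exists s\in\Sigma_r,\ f(x)-\lambda=s(x)\ \forall x\in\mathbb{B}^n\},$$ $$f^{(r)}:=\inf_{s\in\Sigma_r}\Big\{\int_{\mathbb{B}^n}f(x)s(x)\,d\mu(x):\int_{\mathbb{B}^n}s(x)\,d\mu(x)=1\Big\}.$$ The constant $C_d$: it is the absolute constant, depending only on $d$, that appears in the following non-asymptotic error bound. Let $\xi^n_r$ be the least root of the degree $r$ Krawtchouk polynomial $\mathcal{K}^n_r(t)=\sum_{i=0}^r(-1)^i\binom{t}{i}\binom{n-t}{r-i}$. For every polynomial $f$ of degree $d\le n$, if $(r+1)/n\le 1/2$ and $d(d+1)\,\xi^n_{r+1}/n\le 1/2$, then $(f_{\min}-f_{(r)})/\|f\|_\infty\le 2C_d\,\xi^n_{r+1}/n$. Explicitly, $C_d=d(d+1)\gamma_d$. Here $\gamma_d>0$ is a constant depending only on $d$ (not on $n$) such that $\|p_k\|_\infty\le\gamma_d\|p\|_\infty$ for all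 $n\ge d$, all $0\le k\le d$ and every polynomial $p$ of degree at most $d$ on $\mathbb{B}^n$, where $p=p_0+\dots+p_d$ is the harmonic decomposition of $p$, i.e. $p_k$ lies in the span of the characters $\chi_a(x)=(-1)^{a\cdot x}$ with $a\in\{0,1\}^n$ having exactly $k$ ones. Such a $\gamma_d$ exists. With the same constant $C_d$ one also has $(f^{(r)}-f_{\min})/\|f\|_\infty\le C_d\,\xi^n_{r+1}/n$ whenever $(r+1)/n\le 1/2$. *)

(* Defs.v *)
(* MathComp-Analysis, with {mpoly R[n]} from multinomials for polynomials. *)
From HB Require Import structures.
From mathcomp Require Import all_boot all_order all_algebra.
From mathcomp Require Import all_classical all_reals all_analysis.
(* The notations of mpoly clash with those of analysis. *)
From mathcomp Require mpoly.
Export -(notations) mpoly.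

Set Implicit Arguments.
Unset Strict Implicit.
Unset Printing Implicit Defensive.

Import Order.TTheory GRing.Theory Num.Theory.
Import numFieldNormedType.Exports.
Local Open Scope classical_set_scope.
Local Open Scope ring_scope.

Definition cube (n : nat) : finType := {ffun 'I_n -> bool}.

Section Cube.
Context {R : realType} {n : nat}.
Implicit Types (g : cube n -> R) (p s : mpoly n R).

(* The default value of the iterated minimum is itself a value of g. *)
Definition cube_min g : R := \big[Num.min/g [ffun=> false]]_(x : cube n) g x.

Definition cube_norm g : R := \big[Num.max/0]_(x : cube n) `|g x|.

(* Integral against the uniform probability measure on the cube. *)
Definition cube_mean g : R := (2 ^+ n)^-1 * \sum_(x : cube n) g x.

Definition on_cube p : cube n -> R := fun x => meval (fun i => (x i)%:R) p.

(* msize is the total degree plus one, and 0 for the zero polynomial. *)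
Definition deg_le (d : nat) p : Prop := (msize p <= d.+1)%N.

Definition sos (r : nat) s : Prop :=
  exists ps : seq (mpoly n R),
    (forall p, p \in ps -> deg_le r p) /\ s = \sum_(p <- ps) p ^+ 2.

Definition weight (a : cube n) : nat := #|[pred i | a i]|.

Definition character (a x : cube n) : R :=
  (-1) ^+ (\sum_(i < n) (a i : nat) * (x i : nat))%N.

(* Membership in the span of the characters of weight k. *)
Definition harmonic (k : nat) g : Prop :=
  exists c : cube n -> R,
    forall x, g x = \sum_(a : cube n | weight a == k) c a * character a x.

(* The bounds are extended reals: for small r no s may be feasible in the
   outer bound, which is then -oo. *)
Definition outer_bound (r : nat) p : \bar R :=
  ereal_sup [set l%:E | l in [set l : R |
    exists s, sos r s /\ forall x, on_cube p x - l = on_cube s x]].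

Definition inner_bound (r : nat) p : \bar R :=
  ereal_inf [set (cube_mean (fun x => on_cube p x * on_cube s x))%:E | s in
    [set s | sos r s /\ cube_mean (on_cube s) = 1]].

End Cube.

Section Errors.
Variable R : realType.
Local Open Scope ereal_scope.

Definition outer_error (d r n : nat) : \bar R :=
  ereal_sup [set (cube_min (on_cube f))%:E - outer_bound r f | f in
    [set f : mpoly n R | deg_le d f /\ cube_norm (on_cube f) = 1%R]].

Definition inner_error (d r n : nat) : \bar R :=
  ereal_sup [set inner_bound r f - (cube_min (on_cube f))%:E | f in
    [set f : mpoly n R | deg_le d f /\ cube_norm (on_cube f) = 1%R]].

End Errors.

(* gamma bounds, uniformly in the dimension n >= d, the sup-norm operator norms
   of the projections onto the harmonic components in degree at most d. *)
Definition harmonic_constant {R : realType} (d : nat) (gamma : R) : Prop :=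
  0 < gamma /\
  forall (n : nat) (p : mpoly n R) (h : nat -> cube n -> R),
    (d <= n)%N -> deg_le d p ->
    (forall k, (k <= d)%N -> harmonic k (h k)) ->
    (forall x, on_cube p x = \sum_(k < d.+1) h k x) ->
    forall k, (k <= d)%N -> cube_norm (h k) <= gamma * cube_norm (on_cube p).

Definition C_const {R : realType} (d : nat) (gamma : R) : R :=
  (d * d.+1)%:R * gamma.

Definition phi {R : realType} (t : R) : R := 1 / 2 - Num.sqrt (t * (1 - t)).

(* Main.v *)
Require Import Defs.
From mathcomp Require Import all_boot all_order all_algebra.
From mathcomp Require Import perm.
From mathcomp Require Import all_classical all_reals all_analysis.
From mathcomp Require Import ring lra.
Import Order.TTheory GRing.Theory Num.Theory.
Import numFieldNormedType.Exports.
Local Open Scope classical_set_scope.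
Local Open Scope ring_scope.

Set Implicit Arguments.
Unset Strict Implicit.
Unset Printing Implicit Defensive.

(* Let u be a zonal function, u(x) = \sum_b c_|b| chi_b(x) with c_k = 0 for k > r,
   normalised by E[u^2] = 1. Convolution on the group {0,1}^n with w = u^2 acts
   on the harmonic component of degree k as a scalar lambda_k, the Fourier
   coefficient of w, and 0 <= 1 - lambda_k <= 2 k rho with rho = (1 - lambda_1) / 2,
   because 1 - chi_a <= \sum_(i in a) (1 - chi_i). Inner bound: the density
   x |-> w(x0 + x) at a minimiser x0 gives
     f^(r) - f_min <= \sum_k (1 - lambda_k) |f_k(x0)| <= d (d + 1) gamma rho.
   Outer bound: if l = f_min - C rho / (1 - 2 d rho), then
   g = \sum_k f_k / lambda_k - l is nonnegative, so f - l = g * w is a combination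
   of the squares u(x + z)^2 with nonnegative weights g(z).

   The least root of the Krawtchouk polynomial is the minimum of n rho over all
   u. It never has to be computed: spreading u evenly over the degrees
   r - m, ..., r, with m fixed, gives
     rho <= 1/2 - m / (m + 1) sqrt ((r - m) / n * (1 - r / n)),
   which tends to phi(t) as r / n -> t and then m -> oo. *)

(** * The cube as a group, coordinate permutations and weights *)

Section Cube.
Context {n : nat}.
Implicit Types a b x y z : cube n.

Definition cxor x y : cube n := [ffun i => x i (+) y i].

Definition cunit (i : 'I_n) : cube n := [ffun j => j == i].

Definition cperm (s : {perm 'I_n}) x : cube n := [ffun i => x (s i)].

Lemma cxorC x y : cxor x y = cxor y x.
Proof. by apply/ffunP=> i; rewrite !ffunE addbC. Qed.

Lemma cxorK z : involutive (cxor z).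
Proof. by move=> x; apply/ffunP=> i; rewrite !ffunE addKb. Qed.

Lemma cxor_eq0 x y : (cxor x y == [ffun=> false]) = (x == y).
Proof.
apply/eqP/eqP => [/ffunP h|->]; apply/ffunP=> i; last by rewrite !ffunE addbb.
by move: (h i); rewrite !ffunE; case: (x i); case: (y i).
Qed.

Lemma cperm_inj s : injective (cperm s).
Proof.
move=> x y /ffunP h; apply/ffunP=> i.
by move: (h (invF (@perm_inj _ s) i)); rewrite !ffunE (f_invF (@perm_inj _ s)).
Qed.

Lemma weight_le a : (weight a <= n)%N.
Proof. by rewrite -[X in (_ <= X)%N]card_ord max_card. Qed.

Lemma weightE a : weight a = (\sum_i a i)%N.
Proof.
rewrite /weight -sum1_card big_mkcond /=; apply: eq_bigr => i _.
by rewrite inE; case: (a i).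
Qed.

Lemma weight_cunit i : weight (cunit i) = 1%N.
Proof.
rewrite weightE (bigD1 i) //= ffunE eqxx big1 // => j /negbTE h.
by rewrite ffunE h.
Qed.

Lemma weight_flip b i :
  weight (cxor b (cunit i)) = if b i then (weight b).-1 else (weight b).+1.
Proof.
rewrite !weightE (bigD1 i) //= [in RHS](bigD1 i) //= !ffunE eqxx addbT.
rewrite (eq_bigr (fun j => b j : nat)); last first.
  by move=> j /negbTE h; rewrite !ffunE h addbF.
by case: (b i).
Qed.

(** Read as tuples, [a] and [b] contain equally many [true] and equally many [false], so each is a
    rearrangement of the other. *)
Lemma weight_perm a b : weight a = weight b -> exists s, b = cperm s a.
Proof.
move=> h; pose t (c : cube n) := [tuple c i | i < n].
have ht c : count_mem true (t c) = weight c.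
  rewrite weightE -sumn_count sumnE big_map big_map big_enum /=.
  by apply: eq_bigr => i _; rewrite eqb_id.
have hf c : count_mem false (t c) = (n - weight c)%N.
  rewrite -ht -[X in (X - _)%N](size_tuple (t c)).
  rewrite -(count_predC (pred1 true)) addKn.
  by apply: eq_count => -[].
have /tuple_permP[s hs] : perm_eq (t b) (t a).
  by apply/allP => -[] _ /=; rewrite ?ht ?hf h.
exists s; apply/ffunP => i; rewrite ffunE.
have /(congr1 (fun u : n.-tuple bool => tnth u i)) := val_inj hs.
by rewrite !tnth_mktuple.
Qed.

End Cube.

(** * Characters, the uniform mean and Fourier inversion *)

Section Fourier.
Context {R : realType} {n : nat}.
Implicit Types (a b x y z : cube n) (g w : cube n -> R) (p : mpoly n R).

Lemma character_prod a x : character a x = \prod_i (-1) ^+ (a i && x i) :> R.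
Proof.
by rewrite /character GRing.expr_sum; apply: eq_bigr => i _; rewrite mulnb.
Qed.

Lemma characterC a x : character a x = character x a :> R.
Proof. by rewrite !character_prod; apply: eq_bigr => i _; rewrite andbC. Qed.

Lemma characterMr a x y :
  character a (cxor x y) = character a x * character a y :> R.
Proof.
rewrite !character_prod -big_split; apply: eq_bigr => i _ /=.
by rewrite ffunE andb_addr signr_addb.
Qed.

Lemma characterMl a b x :
  character (cxor a b) x = character a x * character b x :> R.
Proof. by rewrite characterC characterMr !(characterC x). Qed.

Lemma character_cunit i x : character (cunit i) x = (-1) ^+ x i :> R.
Proof.
rewrite character_prod (bigD1 i) //= ffunE eqxx big1 ?mulr1 // => j /negbTE h.
by rewrite ffunE h.
Qed.

Lemma character0 x : character [ffun=> false] x = 1 :> R.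
Proof. by rewrite character_prod big1 // => i _; rewrite ffunE. Qed.

Lemma character_perm s a x :
  character (cperm s a) (cperm s x) = character a x :> R.
Proof.
rewrite !character_prod [RHS](reindex_inj (@perm_inj _ s)).
by apply: eq_bigr => i _; rewrite !ffunE.
Qed.

Lemma character_sqr a x : character a x * character a x = 1 :> R.
Proof.
have /eqP xx : cxor x x == [ffun=> false] by rewrite cxor_eq0.
by rewrite -characterMr xx characterC character0.
Qed.

Lemma eq_cube_mean g1 g2 : g1 =1 g2 -> cube_mean g1 = cube_mean g2.
Proof. by move=> h; congr (_ * _); apply: eq_bigr => x _. Qed.

Lemma cube_meanZ c g : cube_mean (fun x => c * g x) = c * cube_mean g.
Proof. by rewrite /cube_mean -mulr_sumr mulrCA. Qed.

Lemma cube_mean_sum (I : Type) (s : seq I) (P : pred I) (G : I -> cube n -> R) :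
  cube_mean (fun x => \sum_(i <- s | P i) G i x) =
  \sum_(i <- s | P i) cube_mean (G i).
Proof. by rewrite /cube_mean exchange_big mulr_sumr. Qed.

Lemma cube_meanB g1 g2 :
  cube_mean (fun x => g1 x - g2 x) = cube_mean g1 - cube_mean g2.
Proof. by rewrite /cube_mean sumrB mulrBr. Qed.

Lemma cube_mean_ge0 g : (forall x, 0 <= g x) -> 0 <= cube_mean g.
Proof. by move=> h; rewrite mulr_ge0 ?invr_ge0 ?exprn_ge0 ?sumr_ge0. Qed.

Lemma cube_mean_le g1 g2 :
  (forall x, g1 x <= g2 x) -> cube_mean g1 <= cube_mean g2.
Proof. by move=> h; rewrite ler_wpM2l ?invr_ge0 ?exprn_ge0 ?ler_sum. Qed.

Lemma cube_mean_xor z g : cube_mean (fun x => g (cxor z x)) = cube_mean g.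
Proof.
by congr (_ * _); rewrite [RHS](reindex_inj (inv_inj (cxorK z))).
Qed.

Lemma cube_mean_perm s g : cube_mean (fun x => g (cperm s x)) = cube_mean g.
Proof. by congr (_ * _); rewrite [RHS](reindex_inj (@cperm_inj _ s)). Qed.

(** For [a] with a coordinate [i] set, translation by [cunit i] preserves the mean but flips the
    sign of the character. *)
Lemma cube_mean_character a :
  cube_mean (character a) = (a == [ffun=> false])%:R :> R.
Proof.
case: eqP => [->|/eqP a0].
  rewrite /cube_mean (eq_bigr (fun=> 1)) => [|x _]; last exact: character0.
  rewrite sumr_const card_ffun card_bool card_ord natrX mulVf //.
have [i ai] : exists i, a i.
  apply/existsP; apply: contraNT a0 => /existsPn h.
  by apply/eqP/ffunP => i; rewrite ffunE; apply/negbTE/h.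
have := cube_mean_xor (cunit i) (character a).
rewrite (eq_cube_mean (fun x => characterMr a (cunit i) x)) cube_meanZ.
by rewrite characterC character_cunit ai expr1 mulN1r => h; apply/eqP; rewrite -eqNr h.
Qed.

Definition fourier g a := cube_mean (fun x => g x * character a x).

Lemma sum_character x y :
  \sum_a character a x * character a y = 2 ^+ n * (x == y)%:R :> R.
Proof.
rewrite -cxor_eq0 -cube_mean_character mulrA mulfV ?mul1r; last first.
  by rewrite expf_neq0 // pnatr_eq0.
by apply: eq_bigr => a _; rewrite -characterMr characterC.
Qed.

Lemma fourier_inversion g x : g x = \sum_a fourier g a * character a x.
Proof.
rewrite /fourier /cube_mean.
under eq_bigr do rewrite -mulrA mulr_suml.
rewrite -mulr_sumr exchange_big /=.
under eq_bigr => y _.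
  under eq_bigr do rewrite -mulrA.
  rewrite -mulr_sumr sum_character mulrCA.
  over.
rewrite -mulr_sumr mulrA mulVf ?mul1r; last by rewrite expf_neq0 // pnatr_eq0.
rewrite (bigD1 x) //= eqxx mulr1 big1 ?addr0 // => y /negbTE h.
by rewrite h mulr0.
Qed.

Lemma fourier_sum (c : cube n -> R) a :
  fourier (fun x => \sum_b c b * character b x) a = c a.
Proof.
rewrite /fourier.
under eq_cube_mean do rewrite mulr_suml.
rewrite cube_mean_sum (bigD1 a) //= big1 => [|b ba].
  under eq_cube_mean do rewrite -mulrA -characterMl.
  by rewrite cube_meanZ cube_mean_character cxor_eq0 eqxx mulr1 addr0.
under eq_cube_mean do rewrite -mulrA -characterMl.
by rewrite cube_meanZ cube_mean_character cxor_eq0 (negbTE ba) mulr0.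
Qed.

Lemma fourier_xor g z a :
  fourier (fun x => g (cxor z x)) a = character a z * fourier g a.
Proof.
rewrite /fourier -cube_meanZ.
rewrite -[RHS](cube_mean_xor z); apply: eq_cube_mean => x.
by rewrite characterMr mulrCA; congr (_ * _); rewrite mulrA character_sqr mul1r.
Qed.

(** Translation by [cunit i] multiplies the coefficient by -1, while invariance keeps it fixed. *)
Lemma fourier_invariant g a i : a i ->
  (forall x, g (cxor (cunit i) x) = g x) -> fourier g a = 0.
Proof.
move=> ai h; have := fourier_xor g (cunit i) a.
have -> : fourier (fun x => g (cxor (cunit i) x)) a = fourier g a.
  by apply: eq_cube_mean => x; rewrite h.
by rewrite characterC character_cunit ai expr1 mulN1r => /esym/eqP; rewrite eqNr => /eqP.
Qed.

(** Degree of a function on the cube, read off its Fourier support and so independent of the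
    polynomial representing it. *)
Definition low_degree d g := forall a, (d < weight a)%N -> fourier g a = 0.

(* Each monomial has a variable of [a] missing, so flipping it changes only the
   sign of the character. *)
Lemma low_degree_on_cube d p : deg_le d p -> low_degree d (on_cube p).
Proof.
move=> hd a ha; rewrite /fourier /on_cube.
under eq_cube_mean do rewrite mevalE mulr_suml.
rewrite cube_mean_sum big_seq big1 // => m mp.
under eq_cube_mean do rewrite -mulrA.
rewrite cube_meanZ; apply/eqP; rewrite mulf_eq0; apply/orP; right; apply/eqP.
have /existsP[i /andP[ai /eqP mi]] : [exists i, a i && (m i == 0%N)].
  apply: contraLR ha => /existsPn h; rewrite -leqNgt.
  apply: leq_trans (_ : mdeg m <= d)%N; last first.
    by rewrite -ltnS; apply: leq_trans (msize_mdeg_lt mp) hd.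
  rewrite mdegE weightE; apply: leq_sum => i _.
  by move: (h i); case: (a i) => //=; rewrite lt0n.
apply: (@fourier_invariant (fun x => \prod_i (x i)%:R ^+ m i) a i ai) => x.
apply: eq_bigr => j _; rewrite !ffunE.
by case: eqP => [->|//]; rewrite mi !expr0.
Qed.

End Fourier.

(** Initial segments serve as representatives of the weight classes, which makes the eigenvalue a
    function of [k] alone. *)
Lemma weight_initial n k : (k <= n)%N -> weight [ffun i : 'I_n => (i < k)%N] = k.
Proof.
move=> kn; rewrite weightE (eq_bigr (fun i : 'I_n => if (i < k)%N then 1 else 0)%N).
  by rewrite -big_mkcond /= -(big_ord_widen n (fun=> 1%N)) // sum1_card card_ord.
by move=> i _; rewrite ffunE; case: ifP.
Qed.

(** * Harmonic components, polynomial representatives and convolution *)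

Section LowDegree.
Context {R : realType} {n : nat}.
Implicit Types (a b x y z : cube n) (g w : cube n -> R) (p : mpoly n R).

Definition component g k x : R :=
  \sum_(a | weight a == k) fourier g a * character a x.

Lemma harmonic_component g k : Defs.harmonic k (component g k).
Proof. by exists (fourier g). Qed.

Lemma component_sum d g x :
  low_degree d g -> g x = \sum_(k < d.+1) component g k x.
Proof.
move=> hd; rewrite [LHS]fourier_inversion.
rewrite (bigID (fun a => weight a < d.+1)%N) /= [X in _ + X]big1 ?addr0.
  rewrite (partition_big (fun a => inord (weight a) : 'I_d.+1) predT) //=.
  apply: eq_bigr => k _; apply: eq_bigl => a; rewrite -val_eqE /=.
  case: (ltnP (weight a) d.+1) => h /=; first by rewrite inordK.
  by apply/esym/negbTE; rewrite gtn_eqF // (leq_trans _ h).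
by move=> a; rewrite -leqNgt => h; rewrite hd // mul0r.
Qed.

Lemma on_cube_sqr p x : on_cube (p ^+ 2) x = on_cube p x ^+ 2.
Proof. exact: rmorphXn. Qed.

Lemma on_cubeZ c p x : on_cube (c *: p) x = c * on_cube p x.
Proof. exact: mevalZ. Qed.

Lemma on_cube_sum (I : Type) (s : seq I) (P : pred I) (F : I -> mpoly n R) x :
  on_cube (\sum_(i <- s | P i) F i) x = \sum_(i <- s | P i) on_cube (F i) x.
Proof. exact: raddf_sum. Qed.

Lemma deg_le0 d : deg_le d (0 : mpoly n R).
Proof. by rewrite /deg_le msize0. Qed.

Lemma deg_leZ d c p : deg_le d p -> deg_le d (c *: p).
Proof. exact/leq_trans/msizeZ_le. Qed.

Lemma deg_leD d p q : deg_le d p -> deg_le d q -> deg_le d (p + q).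
Proof.
by move=> hp hq; apply: leq_trans (mmeasureD_le _ _ _) _; rewrite geq_max hp.
Qed.

Lemma deg_leM d1 d2 p q :
  deg_le d1 p -> deg_le d2 q -> deg_le (d1 + d2) (p * q).
Proof.
have [->|p0] := eqVneq p 0; first by rewrite mul0r => _ _; exact: deg_le0.
have [->|q0] := eqVneq q 0; first by rewrite mulr0 => _ _; exact: deg_le0.
rewrite /deg_le msizeM // => hp hq; rewrite -subn1 leq_subLR add1n.
by rewrite -addSn -addnS leq_add.
Qed.

(** Uses (-1)^t = 1 - 2t for t in {0,1}. *)
Definition character_poly a : mpoly n R :=
  \prod_i (if a i then 1 - 2 *: mpolyX R (mnm1 i) else 1).

Lemma on_cube_character a x : on_cube (character_poly a) x = character a x.
Proof.
rewrite /on_cube rmorph_prod character_prod; apply: eq_bigr => i _ /=.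
case: (a i); last by rewrite meval1.
rewrite mevalB meval1 mevalZ mevalXU /=.
by case: (x i); rewrite ?expr0 ?expr1 ?mulr1n ?mulr0n; lra.
Qed.

Lemma deg_le_character a : deg_le (weight a) (character_poly a).
Proof.
rewrite weightE /character_poly.
elim/big_rec2: _ => [|i p k _ hk]; first by rewrite /deg_le msize1.
apply: deg_leM => //; case: (a i); last by rewrite /deg_le msize1.
rewrite -scaleNr; apply: deg_leD; first by rewrite /deg_le msize1.
by apply: deg_leZ; rewrite /deg_le msizeX mdeg1.
Qed.

(** Converse of [low_degree_on_cube], by writing the Fourier expansion with [character_poly]. It
    makes kernels given as functions available to [sos]. *)
Lemma low_degree_poly d g :
  low_degree d g -> exists2 p, deg_le d p & on_cube p =1 g.
Proof.
move=> hd; exists (\sum_a fourier g a *: character_poly a).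
  elim/big_ind: _ => [|p q|a _]; [exact: deg_le0|exact: deg_leD|].
  have [h|h] := leqP (weight a) d.
    by apply: deg_leZ; apply: leq_trans (deg_le_character a) _.
  by rewrite hd // scale0r; exact: deg_le0.
move=> x; rewrite [RHS]fourier_inversion on_cube_sum.
by apply: eq_bigr => a _; rewrite on_cubeZ on_cube_character.
Qed.

Lemma low_degree_xor d g z :
  low_degree d g -> low_degree d (fun x => g (cxor z x)).
Proof. by move=> hd a ha; rewrite fourier_xor hd // mulr0. Qed.

(** Every group element is its own inverse, so [cxor x y] is the difference in a convolution. *)
Definition conv w g x := cube_mean (fun y => g y * w (cxor x y)).

Lemma conv_character w a x : conv w (character a) x = fourier w a * character a x.
Proof.
rewrite mulrC /fourier -cube_meanZ -[LHS](cube_mean_xor x).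
apply: eq_cube_mean => y; rewrite cxorK characterMr -mulrA.
by rewrite (mulrC (w y)).
Qed.

Lemma convZ w c g x : conv w (fun y => c * g y) x = c * conv w g x.
Proof. by rewrite -cube_meanZ; apply: eq_cube_mean => y; rewrite mulrA. Qed.

Lemma convB w g1 g2 x :
  conv w (fun y => g1 y - g2 y) x = conv w g1 x - conv w g2 x.
Proof. by rewrite -cube_meanB; apply: eq_cube_mean => y; rewrite mulrBl. Qed.

Lemma conv_sum w (I : Type) (s : seq I) (P : pred I) (G : I -> cube n -> R) x :
  conv w (fun y => \sum_(i <- s | P i) G i y) x =
  \sum_(i <- s | P i) conv w (G i) x.
Proof.
by rewrite -cube_mean_sum; apply: eq_cube_mean => y; rewrite mulr_suml.
Qed.

Lemma conv_cst w c x : conv w (fun=> c) x = c * cube_mean w.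
Proof. by rewrite -(cube_mean_xor x) -cube_meanZ. Qed.

Lemma conv_component w lam g k x :
  (forall a, weight a = k -> fourier w a = lam) ->
  conv w (component g k) x = lam * component g k x.
Proof.
move=> h; rewrite conv_sum mulr_sumr; apply: eq_bigr => a /eqP ak.
by rewrite convZ conv_character h // mulrCA.
Qed.

End LowDegree.

(** * Fourier coefficients of a probability density on the cube *)

Section Kernel.
Context {R : realType} {n : nat}.
Implicit Types (a b x y z : cube n) (g w : cube n -> R) (p : mpoly n R).

(** The permutation carrying [a] to [b] can be substituted in the mean, where it leaves [w]
    unchanged. *)
Lemma fourier_weight w a b : (forall s x, w (cperm s x) = w x) ->
  weight a = weight b -> fourier w a = fourier w b.
Proof.
move=> hs /weight_perm[s ->].
rewrite /fourier -[RHS](cube_mean_perm s); apply: eq_cube_mean => x.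
by rewrite hs character_perm.
Qed.

Lemma character_le1 a x : character a x <= 1 :> R.
Proof. by rewrite /character -signr_odd; case: odd; rewrite ?expr1 ?expr0; lra. Qed.

Lemma character_geN1 a x : -1 <= character a x :> R.
Proof. by rewrite /character -signr_odd; case: odd; rewrite ?expr1 ?expr0; lra. Qed.

(** If [a] and [x] share no coordinate the left side is 0; otherwise a shared coordinate alone
    contributes 2, the largest value the left side can take. *)
Lemma one_sub_character_le a x :
  1 - character a x <= \sum_(i | a i) (1 - character (cunit i) x) :> R.
Proof.
have h0 i : 0 <= 1 - character (cunit i) x :> R.
  by rewrite subr_ge0 character_le1.
case: (pickP (fun i => a i && x i)) => [i /andP[ai xi]|ax].
  rewrite (bigD1 i) //= character_cunit xi expr1.
  apply: le_trans (_ : 1 - -1 <= _); last by rewrite lerDl sumr_ge0.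
  by rewrite lerB // character_geN1.
rewrite character_prod big1 ?subrr ?sumr_ge0 // => i _.
by rewrite ax.
Qed.

Section Bounds.
Variables (w : cube n -> R) (rho : R).
Hypothesis w_ge0 : forall x, 0 <= w x.
Hypothesis w_mean : cube_mean w = 1.
Hypothesis w_rho : forall i, 1 - fourier w (cunit i) <= 2 * rho.

Lemma one_sub_fourier a :
  1 - fourier w a = cube_mean (fun x => w x * (1 - character a x)).
Proof.
rewrite -[X in X - _]w_mean -cube_meanB; apply: eq_cube_mean => x.
by rewrite mulrBr mulr1.
Qed.

Lemma fourier_le1 a : fourier w a <= 1.
Proof.
rewrite -subr_ge0 one_sub_fourier; apply: cube_mean_ge0 => x.
by rewrite mulr_ge0 // subr_ge0 character_le1.
Qed.

Lemma one_sub_fourier_le a : 1 - fourier w a <= 2 * (weight a)%:R * rho.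
Proof.
rewrite one_sub_fourier.
apply: (@le_trans _ _ (\sum_(i | a i) (1 - fourier w (cunit i)))).
  under [leRHS]eq_bigr do rewrite one_sub_fourier.
  rewrite -cube_mean_sum; apply: cube_mean_le => x.
  by rewrite -mulr_sumr ler_wpM2l ?w_ge0 ?one_sub_character_le.
apply: (@le_trans _ _ (\sum_(i | a i) 2 * rho)); first exact: ler_sum.
rewrite sumr_const -[leLHS]mulr_natr mulrAC; exact: lexx.
Qed.

End Bounds.

Lemma cube_min_le g x : cube_min g <= g x.
Proof. exact: bigmin_le. Qed.

Lemma cube_min_attained g : exists x, cube_min g = g x.
Proof.
rewrite /cube_min; elim/big_ind: _ => [|u v [x ->] [y ->]|x _]; try by eexists.
by rewrite minEle; case: ifP; eexists.
Qed.

End Kernel.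

Lemma sum_ordS (R : realType) d : \sum_(k < d.+1) k%:R = (d * d.+1)%:R / 2 :> R.
Proof.
elim: d => [|d IH]; first by rewrite big_ord_recr big_ord0 /= mul0n; lra.
by rewrite big_ord_recr /= IH !natrM -!natr1; field.
Qed.

(** * Bounds on both errors from a symmetric kernel that is a square *)

Section ErrorBounds.
Context {R : realType} {n : nat}.
Variables (d r : nat) (gamma rho : R) (u : cube n -> R).
Hypothesis hgamma : harmonic_constant d gamma.
Hypothesis dn : (d <= n)%N.
Hypothesis rho_ge0 : 0 <= rho.
Hypothesis hu : low_degree r u.
Let w x := u x ^+ 2.
Hypothesis w_sym : forall s x, w (cperm s x) = w x.
Hypothesis w_mean : cube_mean w = 1.
Hypothesis w_rho : forall i, 1 - fourier w (cunit i) <= 2 * rho.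

Let w_ge0 x : 0 <= w x. Proof. exact: sqr_ge0. Qed.

(** The eigenvalue of [conv w] on the component of degree [k]. *)
Let lam k := fourier w [ffun i : 'I_n => (i < k)%N].

Let lamE k a : weight a = k -> fourier w a = lam k.
Proof.
move=> h; apply: fourier_weight => //.
by rewrite weight_initial // -h weight_le.
Qed.

Let lam_le1 k : lam k <= 1.
Proof. exact: fourier_le1. Qed.

Let one_sub_lam k : (k <= d)%N -> 1 - lam k <= 2 * k%:R * rho.
Proof.
move=> kd; have := one_sub_fourier_le w_ge0 w_mean w_rho [ffun i : 'I_n => (i < k)%N].
by rewrite weight_initial // (leq_trans kd).
Qed.

Let gamma_ge0 : 0 <= gamma.
Proof. by case: hgamma => /ltW. Qed.

Let component_le (f : mpoly n R) k x : deg_le d f -> cube_norm (on_cube f) = 1 ->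
  (k <= d)%N -> `|component (on_cube f) k x| <= gamma.
Proof.
move=> fd f1 kd; case: hgamma => _ /(_ n f (component (on_cube f)) dn fd).
move=> /(_ (fun k _ => harmonic_component _ _)).
move=> /(_ (fun x => component_sum x (low_degree_on_cube fd)) k kd).
by rewrite f1 mulr1; apply: le_trans; exact: le_bigmax.
Qed.

(** Translation only changes signs of Fourier coefficients. The squares of these translates are the
    building blocks of both bounds. *)
Let shifted_poly z :
  exists q : mpoly n R, deg_le r q /\ on_cube q =1 (fun x => u (cxor z x)).
Proof.
by have [q qr hq] := low_degree_poly (low_degree_xor z hu); exists q.
Qed.

Lemma inner_error_le : (inner_error R d r n <= (C_const d gamma * rho)%:E)%E.
Proof.
apply: ge_ereal_sup => _ [f [fd f1] <-].
have [x0 ->] := cube_min_attained (on_cube f).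
have [q [qr hq]] := shifted_poly x0.
(* The translate of [w] to the minimiser [x0] is feasible, being the square of [q], and its
   objective value is the convolution at [x0]. *)
rewrite leeBlDr //; apply: le_trans (_ : (conv w (on_cube f) x0)%:E <= _)%E.
  apply: ereal_inf_lbound; exists (q ^+ 2).
    split.
      exists [:: q]; split; first by move=> p; rewrite inE => /eqP ->.
      by rewrite big_seq1.
    rewrite -w_mean -[RHS](cube_mean_xor x0); apply: eq_cube_mean => x.
    by rewrite on_cube_sqr hq.
  congr (_%:E); apply: eq_cube_mean => x.
  by rewrite on_cube_sqr hq.
rewrite -EFinD lee_fin -lerBlDr.
have -> : conv w (on_cube f) x0 = \sum_(k < d.+1) lam k * component (on_cube f) k x0.
  transitivity (conv w (fun x => \sum_(k < d.+1) component (on_cube f) k x) x0).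
    apply: eq_cube_mean => x; congr (_ * _).
    exact: component_sum (low_degree_on_cube fd).
  by rewrite conv_sum; apply: eq_bigr => k _; apply: conv_component => a; exact: lamE.
rewrite (component_sum x0 (low_degree_on_cube fd)) -sumrB.
apply: (@le_trans _ _ (\sum_(k < d.+1) (2 * k%:R * rho) * gamma)).
  apply: ler_sum => k _; have kd : (k <= d)%N by rewrite -ltnS.
  have /ler_normlP[c1 c2] := component_le x0 fd f1 kd.
  apply: (@le_trans _ _ ((1 - lam k) * gamma)); last first.
    by rewrite ler_wpM2r // one_sub_lam.
  have := lam_le1 k; move: (component _ _ _) c1 c2 => c c1 c2 h; move: gamma_ge0; nra.
rewrite -mulr_suml -mulr_suml -mulr_sumr sum_ordS /C_const.
by rewrite (_ : _ * _ = (d * d.+1)%:R * gamma * rho) //; field.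
Qed.

Lemma outer_error_le : 2 * d%:R * rho < 1 ->
  (outer_error R d r n <= (C_const d gamma * rho / (1 - 2 * d%:R * rho))%:E)%E.
Proof.
set kap := 1 - _; rewrite -subr_gt0 -/kap => kap0.
set delta := _ / kap.
apply: ge_ereal_sup => _ [f [fd f1] <-].
have [x0 hx0] := cube_min_attained (on_cube f).
set fmin := cube_min _ in hx0 *.
(* [delta] bounds how far the values of [f] can drop when each component is divided by its
   eigenvalue. *)
set l := fmin - delta.
suff h : (l%:E <= outer_bound r f)%E.
  move: h; case: (outer_bound r f) => [v| |] //=.
    by rewrite !lee_fin /l; lra.
  (* An outer bound of [+oo] makes the difference [-oo]. *)
  by rewrite addeNy leNye.
(* Eigenvalues up to degree [d] stay above [kap > 0], so convolution can be inverted there. *)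
have kap_le k : (k <= d)%N -> kap <= lam k.
  move=> kd; have := one_sub_lam kd; have : k%:R <= d%:R :> R by rewrite ler_nat.
  rewrite /kap; move: rho_ge0; nra.
(* The preimage of [f - l] under [conv w]: convolution scales component [k] by [lam k] and, [w]
   having mean 1, fixes constants. *)
pose g x := \sum_(k < d.+1) (lam k)^-1 * component (on_cube f) k x - l.
have g_ge0 x : 0 <= g x.
  have fx := cube_min_le (on_cube f) x; rewrite -/fmin in fx.
  have fsum := component_sum x (low_degree_on_cube fd).
  suff : \sum_(k < d.+1) component (on_cube f) k x -
         \sum_(k < d.+1) (lam k)^-1 * component (on_cube f) k x <= delta.
    by move: fx; rewrite fsum /g /l; lra.
  rewrite -sumrB.
  apply: (@le_trans _ _ (\sum_(k < d.+1) (2 * k%:R * rho) * (gamma / kap))).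
    apply: ler_sum => k _; have kd : (k <= d)%N by rewrite -ltnS.
    have /ler_normlP[c1 _] := component_le x fd f1 kd.
    have lam0 := lt_le_trans kap0 (kap_le k kd).
    have -> : component (on_cube f) k x - (lam k)^-1 * component (on_cube f) k x =
        (1 - lam k) * (- component (on_cube f) k x / lam k).
      by field; rewrite gt_eqF.
    have lam1 : 0 <= 1 - lam k by rewrite subr_ge0 lam_le1.
    apply: (@le_trans _ _ ((1 - lam k) * (gamma / kap))).
      apply: ler_wpM2l => //.
      apply: (@le_trans _ _ (gamma / lam k)).
        by rewrite ler_wpM2r // invr_ge0 ltW.
      by rewrite ler_wpM2l ?gamma_ge0 // lef_pV2 ?posrE // kap_le.
    by rewrite ler_wpM2r ?divr_ge0 ?gamma_ge0 ?(ltW kap0) // one_sub_lam.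
  rewrite -mulr_suml -mulr_suml -mulr_sumr sum_ordS /delta /C_const.
  by rewrite le_eqVlt; apply/orP; left; apply/eqP; field; rewrite gt_eqF.
have gE x : conv w g x = on_cube f x - l.
  rewrite convB conv_cst w_mean mulr1; congr (_ - _).
  rewrite conv_sum (component_sum x (low_degree_on_cube fd)).
  apply: eq_bigr => k _; have kd : (k <= d)%N by rewrite -ltnS.
  have lam0 := lt_le_trans kap0 (kap_le k kd).
  rewrite convZ (@conv_component _ _ _ (lam k)) ?mulKf ?gt_eqF // => a.
  exact: lamE.
apply: ereal_sup_ubound; exists l => //.
have [q hq] := choice shifted_poly.
(* The mean in [conv] gives the square of the translate by [z] the weight [g z / 2 ^+ n], whose root
   is absorbed into the polynomial. *)
exists (\sum_(p <- [seq Num.sqrt (g z / 2 ^+ n) *: q z | z <- enum (cube n)]) p ^+ 2).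
split.
  eexists; split; last reflexivity.
  by move=> p /mapP[z _ ->]; apply: deg_leZ; case: (hq z).
move=> x; rewrite -gE on_cube_sum big_map big_enum /= /conv /cube_mean mulr_sumr.
apply: eq_bigr => z _; rewrite on_cube_sqr on_cubeZ exprMn sqr_sqrtr; last first.
  by rewrite divr_ge0 ?exprn_ge0.
by case: (hq z) => _ ->; rewrite (cxorC z) mulrA [_ * g z]mulrC.
Qed.

End ErrorBounds.

(** * Zonal functions and the Fourier coefficients of their squares *)

Lemma weight_cperm n s (a : cube n) : weight (cperm s a) = weight a.
Proof.
rewrite !weightE [RHS](reindex_inj (@perm_inj _ s)).
by apply: eq_bigr => i _; rewrite ffunE.
Qed.

Lemma card_weight n k : #|[pred a : cube n | weight a == k]| = 'C(n, k).
Proof.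
rewrite -[n in RHS]card_ord -card_draws -!sum1_card.
rewrite (reindex (fun A : {set 'I_n} => [ffun i => i \in A] : cube n)) /=.
  apply: eq_bigl => A; rewrite !inE; congr (_ == _).
  by rewrite /weight; apply: eq_card => i; rewrite inE ffunE.
exists (fun a : cube n => [set i | a i]%SET) => [A _|a _].
  by apply/setP => i; rewrite inE ffunE.
by apply/ffunP => i; rewrite ffunE inE.
Qed.

Section Zonal.
Context {R : realType} {n : nat}.
Implicit Types (a b x : cube n) (c : nat -> R).

Lemma sum_weight c :
  \sum_(b : cube n) c (weight b) = \sum_(k < n.+1) c k *+ 'C(n, k).
Proof.
rewrite (partition_big (fun b => inord (weight b) : 'I_n.+1) predT) //=.
apply: eq_bigr => k _; rewrite -card_weight -sumr_const.
apply: eq_big => b; last move=> /eqP <-.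
  by rewrite inE -val_eqE /= inordK // ltnS weight_le.
by rewrite inordK // ltnS weight_le.
Qed.

(** The characters of weight k sum to the Krawtchouk polynomial of degree k at |x|, so this is a
    combination of Krawtchouk polynomials with coefficients [c k]. *)
Definition zonal c x := \sum_(b : cube n) c (weight b) * character b x.

Lemma fourier_zonal c a : fourier (zonal c) a = c (weight a).
Proof. exact: (fourier_sum (fun b => c (weight b))). Qed.

Lemma zonal_perm c s x : zonal c (cperm s x) = zonal c x.
Proof.
rewrite /zonal (reindex_inj (@cperm_inj _ s)).
by apply: eq_bigr => b _; rewrite weight_cperm character_perm.
Qed.

(** Expanding one factor of the square turns the other into its Fourier coefficient at
    [cxor b a]. *)
Lemma fourier_zonal_sqr c a :
  fourier (fun x => zonal c x ^+ 2) a =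
  \sum_b c (weight b) * c (weight (cxor b a)).
Proof.
rewrite /fourier (@eq_cube_mean _ _ _ (fun x =>
    \sum_b c (weight b) * (zonal c x * character (cxor b a) x))) => [|x].
  rewrite cube_mean_sum; apply: eq_bigr => b _.
  by rewrite cube_meanZ -/(fourier _ _) fourier_zonal.
rewrite expr2 -mulrA {1}/zonal mulr_suml; apply: eq_bigr => b _.
by rewrite characterMl -!mulrA; congr (_ * _); rewrite mulrCA.
Qed.

Lemma cube_mean_zonal_sqr c :
  cube_mean (fun x => zonal c x ^+ 2) = \sum_(k < n.+1) c k ^+ 2 *+ 'C(n, k).
Proof.
rewrite -(sum_weight (fun k => c k ^+ 2)).
transitivity (fourier (fun x => zonal c x ^+ 2) [ffun=> false]).
  by apply: eq_cube_mean => x; rewrite character0 mulr1.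
rewrite fourier_zonal_sqr; apply: eq_bigr => b _.
rewrite expr2 (_ : cxor b _ = b) //.
by apply/ffunP => i; rewrite !ffunE addbF.
Qed.

(** By symmetry the left side is the sum over all coordinates. Flipping one coordinate of a point of
    weight k goes up in n - k ways and down in k ways; the two halves agree because (k+1) C(n,k+1) =
    (n-k) C(n,k). *)
Lemma fourier_zonal_cunit c i :
  n%:R * fourier (fun x => zonal c x ^+ 2) (cunit i) =
  2 * \sum_(k < n) c k * c k.+1 * ((n - k) * 'C(n, k))%:R.
Proof.
transitivity (\sum_j fourier (fun x => zonal c x ^+ 2) (cunit j)).
  rewrite (eq_bigr (fun=> fourier (fun x => zonal c x ^+ 2) (cunit i))).
    by rewrite sumr_const card_ord mulr_natl.
  move=> j _; apply: fourier_weight; last by rewrite !weight_cunit.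
  by move=> s x; rewrite zonal_perm.
under eq_bigr do rewrite fourier_zonal_sqr.
rewrite exchange_big /=.
pose F k := c k * (c k.+1 *+ (n - k) + c k.-1 *+ k).
rewrite (eq_bigr (fun b : cube n => F (weight b))) => [|b _]; last first.
  rewrite -mulr_sumr; congr (_ * _).
  rewrite (bigID (fun j => b j)) /= addrC; congr (_ + _).
    rewrite (eq_bigr (fun=> c (weight b).+1)) => [|j /negbTE bj].
      rewrite sumr_const; congr (_ *+ _).
      rewrite -[X in (X - _)%N]card_ord -(cardC [pred j | b j]) addKn.
      by apply: eq_card => j; rewrite !inE.
    by rewrite weight_flip bj.
  rewrite (eq_bigr (fun=> c (weight b).-1)) => [|j bj].
    by rewrite sumr_const; congr (_ *+ _); apply: eq_card => j; rewrite !inE.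
  by rewrite weight_flip bj.
rewrite sum_weight /F /=.
under eq_bigr do rewrite mulrDr mulrnDl.
(* The upward term at weight [n] and the downward term at weight 0 have multiplicity 0. *)
rewrite big_split /= big_ord_recr /= subnn mulr0n mulr0 mul0rn addr0.
rewrite [X in _ + X]big_ord_recl /= mulr0n mulr0 mul0rn add0r.
rewrite mulr_natl mulr2n; congr (_ + _); apply: eq_bigr => k _.
  by rewrite mulr_natr mulrnAr mulrnA.
by rewrite /bump /= add1n mulr_natr mulrnAr -mulrnA mul_bin_left mulrC.
Qed.

End Zonal.

(** * The window kernel *)

Lemma sum_window (V : nmodType) (n l q : nat) (F : nat -> V) : (l + q <= n)%N ->
  \sum_(k < n | (l <= k < l + q)%N) F k = \sum_(l <= k < l + q) F k.
Proof.
move=> h; rewrite (big_nat_widen _ _ _ _ _ h) (big_nat_widenl _ 0%N) // big_mkord.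
by apply: eq_bigl => k; rewrite andbC.
Qed.

Section Window.
Context {R : realType}.
Variables (n l m : nat).
Hypothesis n_gt0 : (0 < n)%N.
Hypothesis lmn : (l + m <= n)%N.

(* With respect to the orthonormal basis of zonal functions this is the vector
   with equal coordinates on [l, l + m], an approximate top eigenvector of
   multiplication by [n - 2|x|], which is a Jacobi matrix in this basis. *)
Definition window k : R :=
  if (l <= k < l + m.+1)%N then (Num.sqrt (m.+1 * 'C(n, k))%:R)^-1 else 0.

Let bin_neq0 k : (k <= n)%N -> 'C(n, k)%:R != 0 :> R.
Proof. by move=> kn; rewrite pnatr_eq0 -lt0n bin_gt0. Qed.

Lemma window_low_degree : low_degree (l + m) (zonal window : cube n -> R).
Proof.
move=> a ha; rewrite fourier_zonal /window addnS ltnS.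
by rewrite [(_ <= l + m)%N]leqNgt ha andbF.
Qed.

Lemma window_mean : cube_mean (fun x : cube n => zonal window x ^+ 2) = 1.
Proof.
rewrite cube_mean_zonal_sqr (bigID (fun k : 'I_n.+1 => l <= k < l + m.+1)%N) /=.
rewrite [X in _ + X]big1 ?addr0; last first.
  by move=> k /negbTE h; rewrite /window h expr0n mul0rn.
rewrite (eq_bigr (fun=> m.+1%:R^-1)) => [|k h]; last first.
  rewrite /window h exprVn sqr_sqrtr ?ler0n // natrM invfM -mulr_natr -mulrA.
  by rewrite mulVf ?mulr1 // bin_neq0 // -ltnS.
rewrite (sum_window (fun=> _)) ?addnS ?ltnS // sumr_const_nat.
by rewrite -addnS addKn -[LHS]mulr_natl mulfV // pnatr_eq0.
Qed.

(** The binomials cancel and leave sqrt((k+1)(n-k)) / (m+1); inside the window k+1 is at least [l]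
    and n-k at least [n - (l + m)]. *)
Lemma window_product k : (l <= k < l + m)%N ->
  m.+1%:R^-1 * Num.sqrt (l * (n - (l + m)))%:R <=
  window k * window k.+1 * ((n - k) * 'C(n, k))%:R.
Proof.
move=> /andP[lk klm]; rewrite /window addnS !ltnS lk (ltnW klm) (leqW lk) klm /=.
have kn : (k < n)%N by exact: leq_trans klm lmn.
set A := 'C(n, k); set B := 'C(n, k.+1).
have A0 : (0 < A)%N by rewrite bin_gt0 ltnW.
have B0 : (0 < B)%N by rewrite bin_gt0.
have AB : (k.+1 * B = (n - k) * A)%N by rewrite mul_bin_left.
rewrite -invfM -sqrtrM ?ler0n // -natrM.
have -> : (m.+1 * A * (m.+1 * B) = m.+1 ^ 2 * (A * B))%N by rewrite mulnACA.
rewrite [(m.+1 ^ 2 * _)%:R]natrM sqrtrM ?ler0n // natrX sqrtr_sqr ger0_norm ?ler0n //.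
rewrite invfM -mulrA ler_wpM2l ?invr_ge0 // mulrC ler_pdivlMr; last first.
  by rewrite sqrtr_gt0 ltr0n muln_gt0 A0.
rewrite -sqrtrM ?ler0n // -[leRHS]ger0_norm ?ler0n // -sqrtr_sqr.
rewrite ler_wsqrtr // -natrM -natrX ler_nat expnS expn1 -{1}AB [leqRHS]mulnACA.
by rewrite (mulnC A) leq_mul2r leq_mul ?orbT ?leq_sub2l // ltnW.
Qed.

(** Each of the [m] adjacent pairs of degrees in the window contributes at least the bound of
    [window_product]; all other terms are nonnegative. *)
Lemma window_cunit i :
  1 - fourier (fun x : cube n => zonal window x ^+ 2) (cunit i) <=
  2 * (1 / 2 - m%:R / m.+1%:R * (Num.sqrt (l * (n - (l + m)))%:R / n%:R)).
Proof.
have nR : 0 < n%:R :> R by rewrite ltr0n.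
have := fourier_zonal_cunit window i.
set f := fourier _ _; set S := \sum_(k < n) _; set s := Num.sqrt _ => hf.
have hS : m%:R * (m.+1%:R^-1 * s) <= S.
  have -> : m%:R * (m.+1%:R^-1 * s) = \sum_(l <= k < l + m) m.+1%:R^-1 * s.
    by rewrite sumr_const_nat addKn mulr_natl.
  rewrite -(sum_window (fun=> _) lmn) big_mkcond.
  apply: ler_sum => k _; case: ifP => [|_]; first exact: window_product.
  by rewrite !mulr_ge0 // /window; case: ifP => // _; rewrite invr_ge0.
have -> : f = 2 * S / n%:R by rewrite -hf mulrC mulKf // gt_eqF.
have -> : m%:R / m.+1%:R * (s / n%:R) = m%:R * (m.+1%:R^-1 * s) / n%:R.
  by rewrite !mulrA.
rewrite -(ler_pM2r (_ : 0 < n%:R^-1)) ?invr_gt0 // in hS.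
by move: hS; rewrite -(mulrA 2); move: (_ / n%:R) (_ / n%:R) => p q; lra.
Qed.

End Window.

(** * Kernels whose parameter approaches [phi t] *)

Lemma phi_ge0 (R : realType) (t : R) : 0 <= phi t.
Proof.
rewrite subr_ge0 -[1 / 2]ger0_norm; last lra.
by rewrite -sqrtr_sqr ler_wsqrtr //; have := sqr_ge0 (t - 1 / 2); nra.
Qed.

(** The limit superior is an infimum of suprema over the filter, and the set where the bound holds
    belongs to the filter. *)
Lemma limn_esup_le_near (R : realType) (u : (\bar R)^nat) (c : \bar R) :
  (\forall j \near \oo, (u j <= c)%E) -> (limn_esup u <= c)%E.
Proof.
move=> h; rewrite /limn_esup limf_esupE.
apply: (@le_trans _ _ (ereal_sup (u @` [set j | (u j <= c)%E]))).
  by apply: ereal_inf_lbound; exists [set j | (u j <= c)%E].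
by apply: ge_ereal_sup => _ [j /= hj <-].
Qed.

Lemma low_degree_le (R : realType) n p q (u : cube n -> R) :
  (p <= q)%N -> low_degree p u -> low_degree q u.
Proof. by move=> pq hu a qa; apply: hu; exact: leq_ltn_trans qa. Qed.

Lemma near_kernel (R : realType) (t : R) (n r : nat -> nat) (eta : R) :
  0 <= t <= 1 / 2 -> n j @[j --> \oo] --> \oo ->
  ((r j)%:R / (n j)%:R : R) @[j --> \oo] --> t -> 0 < eta ->
  \forall j \near \oo, exists u : cube (n j) -> R,
    [/\ low_degree (r j) u,
        forall s x, u (cperm s x) ^+ 2 = u x ^+ 2,
        cube_mean (fun x => u x ^+ 2) = 1 &
        forall i, 1 - fourier (fun x => u x ^+ 2) (cunit i) <= 2 * (phi t + eta)].
Proof.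
move=> /andP[t0 t12] hn hr eta0.
have n0 : \forall j \near \oo, (0 < n j)%N by move/cvgnyPge : hn => /(_ 1%N).
(* At [t = 0] the order [r j] may stay below any window length; the constant kernel suffices, since
   [phi 0 = 1 / 2]. *)
have [t_eq0|t_neq0] := eqVneq t 0.
  near=> j; have nj0 : (0 < n j)%N by near: j.
  exists (zonal (window (n j) 0 0)); split.
  - exact: low_degree_le (leq0n _) (@window_low_degree R (n j) 0 0).
  - by move=> s x; rewrite zonal_perm.
  - exact: window_mean.
  - move=> i; apply: le_trans (window_cunit nj0 _ i) _ => //.
    by rewrite /phi t_eq0 !mul0r sqrtr0; lra.
have {t0 t_neq0} t0 : 0 < t by rewrite lt_def t_neq0.
set s := Num.sqrt (t * (1 - t)).
have s_le : s <= 1 / 2 by rewrite -subr_ge0; exact: phi_ge0.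
(* Gives 1/(m+1) < [eta]; as [s <= 1 / 2], the factor m/(m+1) then costs less than [eta]. *)
pose m := Num.bound eta^-1.
have hm : s - eta < m%:R / m.+1%:R * s.
  have mm : eta^-1 < m.+1%:R.
    apply: lt_trans (archi_boundP _) _; first by rewrite invr_ge0 ltW.
    by rewrite ltr_nat.
  have m0 := ltr0Sn R m.
  have m1 : m.+1%:R^-1 < eta by rewrite -ltf_pV2 ?posrE ?invr_gt0 ?invrK.
  have -> : m%:R / m.+1%:R = 1 - m.+1%:R^-1 :> R.
    by rewrite -natr1; field; rewrite natr1 gt_eqF.
  have : 0 < m.+1%:R^-1 :> R by rewrite invr_gt0.
  by move: m1 s_le; move: (_^-1) s => p q; nra.
have hninv : ((n j)%:R^-1 : R) @[j --> \oo] --> 0.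
  by apply/gtr0_cvgV0; [apply: filterS n0 => j; rewrite ltr0n|exact/cvgrnyP].
have hl : ((r j)%:R / (n j)%:R - m%:R * (n j)%:R^-1 : R) @[j --> \oo] --> t.
  rewrite -[X in _ --> X]subr0 -[X in _ - X](mulr0 m%:R).
  by apply: cvgB => //; apply: cvgMr.
have hk : (1 - (r j)%:R / (n j)%:R : R) @[j --> \oo] --> 1 - t.
  by apply: cvgB => //; exact: cvg_cst.
have hs : (m%:R / m.+1%:R * Num.sqrt (((r j)%:R / (n j)%:R - m%:R * (n j)%:R^-1) *
    (1 - (r j)%:R / (n j)%:R)) : R) @[j --> \oo] --> m%:R / m.+1%:R * s.
  apply: cvgMr.
  exact: (cvg_comp _ _ (cvgM hl hk) (@sqrt_continuous R (t * (1 - t)))).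
near=> j.
have nj0 : (0 < n j)%N by near: j.
have njR : 0 < (n j)%:R :> R by rewrite ltr0n.
(* Positivity of [t] ensures that [r j - m] is not a truncated subtraction. *)
have mr : (m <= r j)%N.
  rewrite -(ler_nat R) -(ler_pM2r (_ : 0 < (n j)%:R^-1)) ?invr_gt0 // -subr_ge0 ltW //.
  by near: j; exact: (cvgr_gt _ hl).
have rn : (r j <= n j)%N.
  rewrite -(ler_nat R) -[leRHS]mul1r -ler_pdivrMr // -subr_ge0 ltW //.
  by near: j; apply: (cvgr_gt _ hk); lra.
have lmn : (r j - m + m <= n j)%N by rewrite subnK.
exists (zonal (window (n j) (r j - m) m)); split.
- apply: (@low_degree_le _ _ (r j - m + m)); first by rewrite subnK.
  exact: (@window_low_degree R (n j) (r j - m) m).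
- by move=> p x; rewrite zonal_perm.
- exact: window_mean.
- move=> i; apply: le_trans (window_cunit nj0 lmn i) _.
  rewrite ler_pM2l ?ltr0n // /phi -/s subnK //.
  set q := _ / _ * _.
  suff : s - eta < q by lra.
  rewrite /q.
  have -> : Num.sqrt ((r j - m) * (n j - r j))%:R / (n j)%:R =
    Num.sqrt (((r j)%:R / (n j)%:R - m%:R * (n j)%:R^-1) *
    (1 - (r j)%:R / (n j)%:R)) :> R.
    rewrite (_ : _ * _ = ((r j - m) * (n j - r j))%:R / (n j)%:R ^+ 2).
      by rewrite sqrtrM ?ler0n // sqrtrV ?exprn_ge0 // sqrtr_sqr gtr0_norm.
    by rewrite natrM !natrB //; field; rewrite gt_eqF.
  by near: j; exact: (cvgr_gt _ hs).
Unshelve. all: by end_near. Qed.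

(** * Passage to the limit *)

Lemma C_const_ge0 (R : realType) d (gamma : R) :
  harmonic_constant d gamma -> 0 <= C_const d gamma.
Proof. by case=> /ltW g0 _; rewrite mulr_ge0. Qed.

Theorem corollary4 (R : realType) (d : nat) (gamma : R)
    (hgamma : harmonic_constant d gamma)
    (t : R) (ht : 0 <= t <= 1 / 2)
    (n r : nat -> nat)
    (hn : n j @[j --> \oo] --> \oo)
    (hr : ((r j)%:R / (n j)%:R : R) @[j --> \oo] --> t) :
  (limn_esup (fun j => inner_error R d (r j) (n j))
     <= (C_const d gamma * phi t)%:E)%E
  /\ ((d * d.+1)%:R * phi t <= 1 / 2 ->
      (limn_esup (fun j => outer_error R d (r j) (n j))
         <= (2 * C_const d gamma * phi t)%:E)%E).
Proof.
have C0 := C_const_ge0 hgamma; set C := C_const d gamma in C0 *.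
have phi0 := phi_ge0 t.
have dn : \forall j \near \oo, (d <= n j)%N by move/cvgnyPge : hn; exact.
split=> [|hphi]; apply/lee_addgt0Pr => e e0; apply: limn_esup_le_near.
  (* The [+ 1] covers [C = 0], which occurs for [d = 0]. *)
  have eta0 : 0 < e / (C + 1) by rewrite divr_gt0 // ltr_wpDl.
  near=> j; have [|u [ur us u1 uc]] := near (near_kernel ht hn hr eta0) j; first by [].
  have dnj : (d <= n j)%N by near: j.
  apply: le_trans (inner_error_le hgamma dnj ur us u1 uc) _.
  rewrite -EFinD lee_fin mulrDr lerD2l mulrA ler_pdivrMr ?ltr_wpDl //.
  by rewrite mulrC ler_wpM2l ?(ltW e0) // lerDl.
(* Holds since 2d <= d(d+1) for every natural d; the factor 2 in the outer bound is the inverse of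
   this 1/2. *)
have dphi : 2 * d%:R * phi t <= 1 / 2.
  apply: le_trans hphi; rewrite ler_wpM2r // -natrM ler_nat mulnC.
  by case: (d) => // k; rewrite leq_mul2l.
set D := 2 * d%:R : R in dphi *.
have D0 : 0 <= D by rewrite mulr_ge0.
have CP : 0 <= C * phi t by rewrite mulr_ge0.
(* Since [1 - D * phi t >= 1 / 2], the choice [eta * M = e / 2] gives
   [C * (phi t + eta) <= (2 * C * phi t + e) * (1 - D * (phi t + eta))]. *)
pose M := C + D * (2 * C * phi t + e) + 1.
have M0 : 0 < M.
  by rewrite ltr_wpDl // addr_ge0 // mulr_ge0 // -mulrA addr_ge0 ?(ltW e0) // mulr_ge0.
pose eta := e / (2 * M).
have eta0 : 0 < eta by rewrite divr_gt0 // mulr_gt0.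
have etaM : eta * M = e / 2 by rewrite /eta; field; rewrite gt_eqF.
have Deta : D * eta < 1 / 2.
  rewrite -(ltr_pM2r e0) (_ : 1 / 2 * e = eta * M); last by rewrite etaM; lra.
  rewrite mulrAC mulrC ltr_pM2l // /M.
  have := mulr_ge0 D0 CP; lra.
near=> j; have [|u [ur us u1 uc]] := near (near_kernel ht hn hr eta0) j; first by [].
have dnj : (d <= n j)%N by near: j.
have rho0 : 0 <= phi t + eta by rewrite addr_ge0 // ltW.
have rho1 : 2 * d%:R * (phi t + eta) < 1 by rewrite -/D mulrDr; lra.
apply: le_trans (outer_error_le hgamma dnj rho0 ur us u1 uc rho1) _.
rewrite -EFinD lee_fin ler_pdivrMr ?subr_gt0 // -/D -/C.
(* Here [dphi] bounds the denominator [1 - D * (phi t + eta)] below by [1 / 2 - D * eta]. *)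
apply: (@le_trans _ _ ((2 * C * phi t + e) * (1 / 2 - D * eta))).
  suff : eta * C + eta * (D * (2 * C * phi t + e)) <= e / 2 by lra.
  by rewrite -etaM /M !mulrDr; lra.
rewrite ler_wpM2l; [by []|lra|lra].
Unshelve. all: by end_near. Qed.
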